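(* Let $(S,\cdot)$ be a semigroup that is an inflation of a subsemigroup $T$ with retraction $r:S\to T$, and let $P=\{p_t\mid t\in T\}\subseteq S$ be an arbitrary transversal of $r$, where $p_t$ denotes the unique element of $P$ with $r(p_t)=t$. Define binary operations on $S$ by $$x\dashv y:=xy,\qquad x\vdash y:=p_{r(x)r(y)}\qquad (x,y\in S).$$ Then $(S,\dashv,\vdash)$ is a $g$-dimonoid whose component semigroups $(S,\dashv)$ and $(S,\vdash)$ are isomorphic. Moreover, $(S,\dashv,\vdash)$ is iso-dual whenever $(S,\dashv)$ is commutative, and $(S,\dashv,\vdash)$ is a dimonoid if and only if $p_t=t$ for all $t\in T^3$.
   Context: Inflation: let $S$ be a semigroup and $T$ a subsemigroup of $S$. A surjective map $r:S\to T$ (not assumed to be a homomorphism) is a retraction if $r(a)=a$ for every $a\in T$. $S$ is an inflation of $T$ with retraction $r$ if $r:S\to T$ is a retraction such that $r(a)r(b)=ab$ for all $a,b\in S$. Transversal: for a surjective map $r:S\to T$, a subset $P\subseteq S$ is a transversal of $r$ if $P$ contains exactly one element of each fiber $r^{-1}(t)$, $t\in T$. $T^3=\{xyz\mid x,y,z\in T\}$. A $g$-dimonoid is a set $D$ with two associative binary operations $\dashv,\vdash$ satisfying, for all $x,y,z\in D$, $(D_1)$ $(x\dashv y)\dashv z=x\dashv(y\vdash z)$ and $(D_3)$ $(x\dashv y)\vdash z=x\vdash(y\vdash z)$. A dimonoid is a $g$-dimonoid which also satisfies $(D_2)$ $(x\vdash y)\dashv z=x\vdash(y\dashv z)$ for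 all $x,y,z\in D$. The dual of a $g$-dimonoid $(D,\dashv,\vdash)$ is the $g$-dimonoid $(D,\dashv^d,\vdash^d)$ with $x\dashv^d y=y\vdash x$ and $x\vdash^d y=y\dashv x$. An isomorphism of $g$-dimonoids is a bijection preserving both operations. A $g$-dimonoid is iso-dual if it is isomorphic to its dual. *)

(* Defs.v *)
From HB Require Import structures.
From mathcomp Require Import all_boot.
From mathcomp Require Import boolp classical_sets functions.

Set Implicit Arguments.
Unset Strict Implicit.
Unset Printing Implicit Defensive.

Local Open Scope classical_set_scope.
Local Open Scope group_scope.

(* Isomorphism of two sets with one binary operation each. *)
Definition isomorphic_op (D E : Type) (op : D -> D -> D) (op' : E -> E -> E) :
    Prop :=
  exists f : D -> E, bijective f /\ {morph f : x y / op x y >-> op' x y}.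

(* Below, la and ra stand for the operations written -| and |-. *)

Record is_gdimonoid (D : Type) (la ra : D -> D -> D) : Prop := IsGDimonoid {
  gdimonoid_laA : associative la;
  gdimonoid_raA : associative ra;
  gdimonoid_D1 : forall x y z, la (la x y) z = la x (ra y z);
  gdimonoid_D3 : forall x y z, ra (la x y) z = ra x (ra y z)
}.

Record is_dimonoid (D : Type) (la ra : D -> D -> D) : Prop := IsDimonoid {
  dimonoid_gdimonoid : is_gdimonoid la ra;
  dimonoid_D2 : forall x y z, la (ra x y) z = ra x (la y z)
}.

Definition isomorphic_gdimonoid (D E : Type)
    (la ra : D -> D -> D) (la' ra' : E -> E -> E) : Prop :=
  exists f : D -> E,
    [/\ bijective f,
        {morph f : x y / la x y >-> la' x y} &
        {morph f : x y / ra x y >-> ra' x y}].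

Definition dual_la (D : Type) (la ra : D -> D -> D) : D -> D -> D :=
  fun x y => ra y x.

Definition dual_ra (D : Type) (la ra : D -> D -> D) : D -> D -> D :=
  fun x y => la y x.

Definition iso_dual (D : Type) (la ra : D -> D -> D) : Prop :=
  isomorphic_gdimonoid la ra (dual_la la ra) (dual_ra la ra).

Definition subsemigroup (S : semigroupType) (T : set S) : Prop :=
  forall x y, T x -> T y -> T (x * y).

(* A map S -> T onto a subset T of S is encoded as a map r : S -> S with
   values in T. *)
Record retraction (S : Type) (T : set S) (r : S -> S) : Prop := Retraction {
  retraction_fun : set_fun setT T r;
  retraction_surj : set_surj setT T r;
  retraction_id : forall a, T a -> r a = a
}.

Record inflation (S : semigroupType) (T : set S) (r : S -> S) : Prop :=
  Inflation {
    inflation_sub : subsemigroup T;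
    inflation_retraction : retraction T r;
    inflation_mul : forall a b : S, r a * r b = a * b
  }.

Definition transversal_of (S : Type) (T : set S) (r : S -> S) (P : set S) :
    Prop :=
  forall t, T t -> exists! x, P x /\ r x = t.

Definition set_cube (S : semigroupType) (T : set S) : set S :=
  [set u | exists x y z, [/\ T x, T y, T z & u = x * y * z]].

Definition inflation_la (S : semigroupType) : S -> S -> S :=
  fun x y => x * y.

Definition inflation_ra (S : semigroupType) (r p : S -> S) : S -> S -> S :=
  fun x y => p (r x * r y).

(* Main.v *)
Require Import Defs.
From mathcomp Require Import all_boot.
From mathcomp Require Import boolp classical_sets functions.

(** In an inflation every product [x * y = r x * r y] lies in [T] and depends
    on [x] and [y] only through [r x] and [r y].  Since [p t] lies in the fiber
    of [r] over [t], the second operation [p (r x * r y)] is the product moved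
    to another point of the same fiber, a change that no further product can
    see.  So any iterated mixed product is determined by the product in [T] of
    the images under [r], and by whether its outermost operation applies [p];
    in each g-dimonoid axiom both sides have the same outermost operation.  In
    [(D2)] the outermost operations differ: it says
    [r x * r y * r z = p (r x * r y * r z)], that is, [p] fixes the cube of
    [T].

    The isomorphism between the components is the involution [fiber_swap] which
    exchanges [t] and [p t] in each fiber of [r]: it stays within the fibers,
    hence is invisible to products, and it sends each product [x * y], a point
    of [T], to [p (x * y)].  Being an involution it also sends [p (x * y)] back
    to [x * y], so it exchanges the two operations; when they are commutative,
    this is an isomorphism onto the dual. *)

Set Implicit Arguments.
Unset Strict Implicit.
Unset Printing Implicit Defensive.

Local Open Scope group_scope.

Section FiberSwap.
Variables (S : eqType) (r p : S -> S).

Definition fiber_swap (x : S) : S :=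
  if x == r x then p (r x) else if x == p (r x) then r x else x.

Hypothesis r_idem : forall x, r (r x) = r x.
Hypothesis pK : forall x, r (p (r x)) = r x.

Lemma retr_fiber_swap x : r (fiber_swap x) = r x.
Proof. by rewrite /fiber_swap; case: eqP => // _; case: eqP. Qed.

Lemma fiber_swap_retr x : fiber_swap (r x) = p (r x).
Proof. by rewrite /fiber_swap r_idem eqxx. Qed.

Lemma fiber_swapK : involutive fiber_swap.
Proof.
move=> x; rewrite {1}/fiber_swap retr_fiber_swap /fiber_swap.
have [-> | x_neq] := eqVneq x (r x).
  (* When [p] fixes [r x], the image [p (r x)] falls under the first test of
     the swap instead of the second; the result is [r x] either way. *)
  by rewrite !r_idem eqxx; case: eqP.
have [<- | x_neq'] := eqVneq x (p (r x)); first by rewrite eqxx.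
by rewrite (negbTE x_neq) (negbTE x_neq').
Qed.

Lemma fiber_swap_bij : bijective fiber_swap.
Proof. by exists fiber_swap; apply: fiber_swapK. Qed.

End FiberSwap.

Lemma inflation_retr_idem (S : semigroupType) (T : set S) (r : S -> S) :
  inflation T r -> forall x, r (r x) = r x.
Proof. by case=> _ [rT _ rid] _ x; apply/rid/rT. Qed.

Lemma inflation_retrM (S : semigroupType) (T : set S) (r : S -> S) :
  inflation T r -> forall x y, r (x * y) = x * y.
Proof.
by case=> Tmul [rT _ rid] rM x y; rewrite -rM rid //; apply: Tmul; apply: rT.
Qed.

Section InflationDimonoid.
Variables (S : semigroupType) (T : set S) (r p : S -> S).
Hypothesis Tr : inflation T r.
Hypothesis pK : forall t, T t -> r (p t) = t.

Local Notation la := (@inflation_la S).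
Local Notation ra := (inflation_ra r p).
Local Notation swap := (fiber_swap r p).

Let rM : forall x y, r x * r y = x * y := inflation_mul Tr.
Let r_idem := inflation_retr_idem Tr.
Let r_mul := inflation_retrM Tr.

Let r_in x : T (r x).
Proof. by case: Tr => _ [rT _ _] _; apply: rT. Qed.

Let prK x : r (p (r x)) = r x.
Proof. exact/pK/r_in. Qed.

Lemma inflation_raE x y : ra x y = p (x * y).
Proof. by rewrite /inflation_ra rM. Qed.

Let r_pmul x y : r (p (x * y)) = x * y.
Proof. by rewrite -r_mul prK. Qed.

(** Moving a factor along its fiber, here by [p], does not change a product. *)
Lemma mul_pmull x y z : p (x * y) * z = x * y * z.
Proof. by rewrite -rM r_pmul -[RHS]rM r_mul. Qed.

Lemma mul_pmulr x y z : x * p (y * z) = x * (y * z).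
Proof. by rewrite -rM r_pmul -[RHS]rM r_mul. Qed.

Lemma inflation_gdimonoid : is_gdimonoid la ra.
Proof.
split=> x y z; rewrite ?inflation_raE /inflation_la ?mul_pmull ?mul_pmulr;
  by rewrite mulgA.
Qed.

Lemma inflation_dimonoidP :
  is_dimonoid la ra <-> forall t, set_cube T t -> p t = t.
Proof.
split=> [[_ D2] t [x [y [z [_ _ _ ->]]]] | pT].
  have := D2 x y z.
  by rewrite !inflation_raE /inflation_la mul_pmull mulgA => <-.
split=> [|x y z]; first exact: inflation_gdimonoid.
rewrite !inflation_raE /inflation_la mul_pmull mulgA pT //.
(* The factors need not lie in [T], but their images under [r] do. *)
by exists (r x), (r y), (r z); split=> //; rewrite rM -[LHS]rM r_mul.
Qed.

Lemma swap_mul x y : swap (x * y) = p (x * y).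
Proof. by rewrite -r_mul fiber_swap_retr. Qed.

Lemma mul_swap x y : swap x * swap y = x * y.
Proof. by rewrite -rM !retr_fiber_swap. Qed.

Lemma swap_la : {morph swap : x y / la x y >-> ra x y}.
Proof. by move=> x y; rewrite inflation_raE mul_swap swap_mul. Qed.

Lemma swap_ra : {morph swap : x y / ra x y >-> la x y}.
Proof.
move=> x y.
by rewrite inflation_raE -swap_mul fiber_swapK // /inflation_la mul_swap.
Qed.

Lemma inflation_isomorphic : isomorphic_op la ra.
Proof. by exists swap; split; [apply: fiber_swap_bij | apply: swap_la]. Qed.

Lemma inflation_iso_dual : commutative la -> iso_dual la ra.
Proof.
move=> laC; exists swap; split; first exact: fiber_swap_bij.
  move=> x y; rewrite laC; exact: swap_la.
by move=> x y; rewrite swap_ra laC.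
Qed.

End InflationDimonoid.

Theorem theorem2p2 (S : semigroupType) (T : set S) (r : S -> S)
    (Tr : inflation T r)
    (P : set S) (TrP : transversal_of T r P)
    (p : S -> S) (pP : forall t, T t -> P (p t) /\ r (p t) = t) :
  let la := @inflation_la S in
  let ra := inflation_ra r p in
  [/\ is_gdimonoid la ra,
      isomorphic_op la ra,
      commutative la -> iso_dual la ra &
      is_dimonoid la ra <-> (forall t, set_cube T t -> p t = t)].
Proof.
have pK t : T t -> r (p t) = t by case/pP.
split.
- exact: inflation_gdimonoid Tr pK.
- exact: inflation_isomorphic Tr pK.
- exact: inflation_iso_dual Tr pK.
- exact: inflation_dimonoidP Tr pK.
Qed.
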